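(* Let $I\subset\mathbb R$ be an open interval, $r:I\to\mathbb R$ a smooth positive function with $(r')^2\neq1$ on $I$, $C\neq0$ a constant, $\eta\in\{1,-1\}$, and fix a sign $\pm$. Assume $$R(u):=(r r''+(r')^2-1)^2\pm 4C^2r^2\,((r')^2-1)>0\quad\text{on } I,$$ and let $\varphi:I\to\mathbb R$ be any function with $\displaystyle\varphi'=\eta\,\frac{\sqrt{R}}{r\,((r')^2-1)}$. Case (A): if $(r')^2>1$ on $I$, let $x_2,x_4$ satisfy $x_2'=\sqrt{(r')^2-1}\,\sinh\varphi$, $x_4'=\sqrt{(r')^2-1}\,\cosh\varphi$. Case (B): if $(r')^2<1$ on $I$, let $x_2,x_4$ satisfy $x_2'=\sqrt{1-(r')^2}\,\cosh\varphi$, $x_4'=\sqrt{1-(r')^2}\,\sinh\varphi$. In either case the curve $c(u)=(r(u),x_2(u),0,x_4(u))$ is a spacelike curve parameterized by arc-length with $x_2'x_4''-x_2''x_4'\neq0$ on $I$, and the rotational surface of hyperbolic type $z(u,v)=(r(u)\cosh v,\,x_2(u),\,r(u)\sinh v,\,x_4(u))$, $v\in\mathbb R$, is a Lorentz surface in $\mathbb E^4_2$ with constant mean curvature ($\langle H,H\rangle=\pm C^2$, a nonzero constant). Conversely, let $z(u,v)=(r(u)\cosh v,x_2(u),r(u)\sinh v,x_4(u))$, $u\in J$, be a rotational surface of hyperbolic type whose generating curve $(r,x_2,0,x_4)$ is spacelike and parameterized by arc-length ($(r')^2+(x_2')^2-(x_4')^2=1$), with $r>0$ and $(r')^2\neq1$,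 and suppose $x_2'x_4''-x_2''x_4'\neq0$ on an open interval $I\subset J$ and $\langle H,H\rangle$ is a nonzero constant on $I$. Then, locally on $I$, the curve is obtained from $r$ by the construction of Case (A) or Case (B) above for some $C\neq0$, sign $\pm$, $\eta\in\{\pm1\}$ and suitable constants of integration.
   Context: $\mathbb E^4_2$ is $\mathbb R^4$ with the neutral metric $\langle\cdot,\cdot\rangle$ given by $g_0=dx_1^2+dx_2^2-dx_3^2-dx_4^2$. A vector $v$ is spacelike if $\langle v,v\rangle>0$. A surface in $\mathbb E^4_2$ is Lorentz if its induced metric has signature $(1,1)$. The mean curvature vector is $H=\frac12\operatorname{tr}\sigma$, where $\sigma$ is the second fundamental form; the surface has constant mean curvature if $\langle H,H\rangle$ is a nonzero constant. A rotational surface of hyperbolic type is $z(u,v)=(r(u)\cosh v,x_2(u),r(u)\sinh v,x_4(u))$, obtained by hyperbolic rotation of the curve $(r(u),x_2(u),0,x_4(u))$, $r>0$, about the Lorentz plane spanned by $e_2=(0,1,0,0)$ and $e_4=(0,0,0,1)$.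
   Formalization: In the converse, the curve is obtained by Case (A) or (B) only up to a common sign multiplying x_2' and x_4' (the isometry (x_2,x_4)→(-x_2,-x_4)); without this sign the converse fails, e.g. for curves with (r')^2>1 and x_4'<0. *)

(* Defs.v *)
From Stdlib Require Import Reals Lra.
Open Scope R_scope.

Record V4 : Type := mkV4 { c1 : R; c2 : R; c3 : R; c4 : R }.

Definition vadd (a b : V4) : V4 :=
  mkV4 (c1 a + c1 b) (c2 a + c2 b) (c3 a + c3 b) (c4 a + c4 b).
Definition vscale (k : R) (a : V4) : V4 :=
  mkV4 (k * c1 a) (k * c2 a) (k * c3 a) (k * c4 a).

Definition ip (a b : V4) : R :=
  c1 a * c1 b + c2 a * c2 b - c3 a * c3 b - c4 a * c4 b.

Definition spacelike (a : V4) : Prop := ip a a > 0.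

Definition is_open_interval (I : R -> Prop) : Prop :=
  (exists x, I x) /\
  (forall x y z, I x -> I y -> x < z < y -> I z) /\
  (forall x, I x -> exists e, e > 0 /\ forall y, Rabs (y - x) < e -> I y).

Definition smooth_on (I : R -> Prop) (f : R -> R) : Prop :=
  exists D : nat -> R -> R, D O = f /\
    forall n x, I x -> derivable_pt_lim (D n) x (D (S n) x).

Definition is_partial_u (D : R -> R -> Prop) (f g : R -> R -> V4) : Prop :=
  forall u v, D u v ->
    derivable_pt_lim (fun t => c1 (f t v)) u (c1 (g u v)) /\
    derivable_pt_lim (fun t => c2 (f t v)) u (c2 (g u v)) /\
    derivable_pt_lim (fun t => c3 (f t v)) u (c3 (g u v)) /\
    derivable_pt_lim (fun t => c4 (f t v)) u (c4 (g u v)).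

Definition is_partial_v (D : R -> R -> Prop) (f g : R -> R -> V4) : Prop :=
  forall u v, D u v ->
    derivable_pt_lim (fun t => c1 (f u t)) v (c1 (g u v)) /\
    derivable_pt_lim (fun t => c2 (f u t)) v (c2 (g u v)) /\
    derivable_pt_lim (fun t => c3 (f u t)) v (c3 (g u v)) /\
    derivable_pt_lim (fun t => c4 (f u t)) v (c4 (g u v)).

Definition surface_partials (D : R -> R -> Prop) (z zu zv zuu zuv zvv : R -> R -> V4) : Prop :=
  is_partial_u D z zu /\ is_partial_v D z zv /\
  is_partial_u D zu zuu /\ is_partial_v D zu zuv /\
  is_partial_u D zv zuv /\ is_partial_v D zv zvv.

Section PointGeometry.
Variables (zu zv zuu zuv zvv : V4).

Definition g11 := ip zu zu.
Definition g12 := ip zu zv.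
Definition g22 := ip zv zv.
Definition gdet := g11 * g22 - g12 * g12.

(* induced metric of signature (1,1) *)
Definition lorentz_at : Prop := gdet < 0.

Definition gi11 := g22 / gdet.
Definition gi12 := - g12 / gdet.
Definition gi22 := g11 / gdet.

Definition normal_part (w : V4) : V4 :=
  let a := ip w zu in
  let b := ip w zv in
  vadd w (vadd (vscale (- (gi11 * a + gi12 * b)) zu)
               (vscale (- (gi12 * a + gi22 * b)) zv)).

(* mean curvature vector H = 1/2 tr sigma, sigma(X,Y) = (D_X Y)^perp *)
Definition mean_curv_vec : V4 :=
  vscale (1/2)
    (vadd (vscale gi11 (normal_part zuu))
      (vadd (vscale (2 * gi12) (normal_part zuv))
            (vscale gi22 (normal_part zvv)))).

Definition HH : R := ip mean_curv_vec mean_curv_vec.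
End PointGeometry.

Definition lorentz_with_HH (D : R -> R -> Prop) (z : R -> R -> V4) (h : R) : Prop :=
  exists zu zv zuu zuv zvv : R -> R -> V4,
    surface_partials D z zu zv zuu zuv zvv /\
    forall u v, D u v ->
      lorentz_at (zu u v) (zv u v) /\
      HH (zu u v) (zv u v) (zuu u v) (zuv u v) (zvv u v) = h.

Definition rot_hyp (r x2 x4 : R -> R) : R -> R -> V4 :=
  fun u v => mkV4 (r u * cosh v) (x2 u) (r u * sinh v) (x4 u).

Definition Rfun (eps C : R) (r r1 r2 : R -> R) (u : R) : R :=
  (r u * r2 u + r1 u ^ 2 - 1) ^ 2 + eps * 4 * C ^ 2 * r u ^ 2 * (r1 u ^ 2 - 1).

Definition phi_rhs (eta eps C : R) (r r1 r2 : R -> R) (u : R) : R :=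
  eta * sqrt (Rfun eps C r r1 r2 u) / (r u * (r1 u ^ 2 - 1)).

Definition is_sign (s : R) : Prop := s = 1 \/ s = -1.

(* Main.v *)
(** Put [a = x2'], [b = x4'], [q = r'^2 - 1], [W = a b' - a' b] and
    [P = r r'' + q].  Arc length means [b^2 - a^2 = q], and a computation of the
    mean curvature vector gives [4 <H,H> r^2 q = r^2 W^2 - P^2].  Hence
    [<H,H> = h] exactly when [r |W| = sqrt (P^2 + 4 h r^2 q)].  In either case
    the angle [phi] satisfies [exp phi = (a + b) / sqrt |q|] up to sign, so
    [phi' = - W / q], which is the prescribed differential equation. *)
Require Import Defs.
From Stdlib Require Import Reals Lra.
From Coquelicot Require Import Coquelicot.
Open Scope R_scope.

(** * Preliminaries on open intervals, local signs and derivatives *)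

Lemma cosh_sqr (v : R) : cosh v ^ 2 = 1 + sinh v ^ 2.
Proof.
  assert (H : exp v * exp (- v) = 1) by (rewrite <- exp_plus, Rplus_opp_r; apply exp_0).
  unfold cosh, sinh; lra.
Qed.

Lemma open_interval_locally (I : R -> Prop) (u : R) :
  is_open_interval I -> I u -> locally u I.
Proof.
  intros (_ & _ & Hop) Hu.
  destruct (Hop u Hu) as (e & He & H).
  exists (mkposreal e He); intros y Hy; apply H; exact Hy.
Qed.

Lemma locally_open_interval (P : R -> Prop) (u : R) :
  locally u P ->
  exists I, is_open_interval I /\ I u /\ forall y, I y -> P y.
Proof.
  intros [e He].
  assert (e0 := cond_pos e).
  exists (fun y => u - e < y < u + e).
  split; [|split].
  - split; [exists u; lra|split].
    + intros x y z; lra.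
    + intros x Hx.
      exists (Rmin (x - (u - e)) (u + e - x)); split.
      * apply Rmin_glb_lt; lra.
      * intros y Hy.
        pose proof (Rmin_l (x - (u - e)) (u + e - x)).
        pose proof (Rmin_r (x - (u - e)) (u + e - x)).
        apply Rabs_def2 in Hy; lra.
  - lra.
  - intros y Hy; apply He.
    change (Rabs (y - u) < e); apply Rabs_def1; lra.
Qed.

Lemma derivable_pt_lim_ext_on (I : R -> Prop) (f g : R -> R) (u l : R) :
  is_open_interval I -> I u -> (forall t, I t -> f t = g t) ->
  derivable_pt_lim f u l -> derivable_pt_lim g u l.
Proof.
  intros HI Hu Hfg Hf.
  apply is_derive_Reals in Hf; apply is_derive_Reals.
  apply (is_derive_ext_loc f); [|exact Hf].
  exact (filter_imp _ _ Hfg (open_interval_locally I u HI Hu)).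
Qed.

Lemma derivable_pt_lim_continuous (f : R -> R) (u l : R) :
  derivable_pt_lim f u l -> continuous f u.
Proof.
  intros H; apply (ex_derive_continuous f u).
  exists l; apply is_derive_Reals; exact H.
Qed.

(** The sign is returned as a factor and not as a case distinction, so that the converse can treat
    all combinations of signs in a single computation. *)
Lemma locally_sign (f : R -> R) (u : R) :
  continuous f u -> f u <> 0 ->
  exists s, is_sign s /\ locally u (fun t => s * f t > 0).
Proof.
  intros Hc Hn.
  destruct (Rlt_or_le (f u) 0) as [Hl|Hl].
  - exists (-1); split; [right; reflexivity|].
    apply (filter_imp (fun t => f t < 0)); [intros; lra|].
    exact (Hc _ (open_lt 0 (f u) Hl)).
  - exists 1; split; [left; reflexivity|].
    apply (filter_imp (fun t => 0 < f t)); [intros; lra|].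
    apply (Hc (fun t => 0 < t)); apply (open_gt 0); lra.
Qed.

(** By uniqueness of limits the smoothness witnesses [D 1] and [D 2] agree on [J] with [f1] and
    [f2], and [D 2] is differentiable. This gives the continuity of [W], which contains second
    derivatives, and hence its constant sign near a point. *)
Lemma smooth_on_continuous_2 (J : R -> Prop) (f f1 f2 : R -> R) (u : R) :
  is_open_interval J -> smooth_on J f ->
  (forall t, J t -> derivable_pt_lim f t (f1 t)) ->
  (forall t, J t -> derivable_pt_lim f1 t (f2 t)) ->
  J u -> continuous f2 u.
Proof.
  intros HJ (D & D0 & HD) H1 H2 Hu.
  assert (E1 : forall t, J t -> D 1%nat t = f1 t).
  { intros t Ht; apply (uniqueness_limite f t); [|now apply H1].
    rewrite <- D0; now apply (HD 0%nat). }
  assert (E2 : forall t, J t -> D 2%nat t = f2 t).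
  { intros t Ht; apply (uniqueness_limite f1 t); [|now apply H2].
    apply (derivable_pt_lim_ext_on J (D 1%nat)); auto. }
  apply (derivable_pt_lim_continuous f2 u (D 3%nat u)).
  apply (derivable_pt_lim_ext_on J (D 2%nat)); auto.
Qed.

(** Differentiate the constant in two ways. For a unit speed curve this is the orthogonality of
    velocity and acceleration. *)
Lemma arc_length_derivative (I : R -> Prop) (f f1 g g1 h h1 : R -> R) (c u : R) :
  is_open_interval I -> I u ->
  (forall t, I t -> f t ^ 2 + g t ^ 2 - h t ^ 2 = c) ->
  derivable_pt_lim f u (f1 u) ->
  derivable_pt_lim g u (g1 u) ->
  derivable_pt_lim h u (h1 u) ->
  f u * f1 u + g u * g1 u - h u * h1 u = 0.
Proof.
  intros HI Hu Hc Hf Hg Hh.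
  assert (H0 : derivable_pt_lim (fun t => f t ^ 2 + g t ^ 2 - h t ^ 2) u 0).
  { apply (derivable_pt_lim_ext_on I (fun _ => c)); auto.
    - intros t Ht; symmetry; now apply Hc.
    - apply derivable_pt_lim_const. }
  apply is_derive_Reals in Hf, Hg, Hh.
  assert (H1 : derivable_pt_lim (fun t => f t ^ 2 + g t ^ 2 - h t ^ 2) u
                 (2 * (f u * f1 u + g u * g1 u - h u * h1 u))).
  { apply is_derive_Reals.
    auto_derive.
    - repeat split; eexists; eassumption.
    - rewrite (is_derive_unique (fun t : R => f t) _ _ Hf), (is_derive_unique (fun t : R => g t) _ _ Hg),
        (is_derive_unique (fun t : R => h t) _ _ Hh); ring. }
  pose proof (uniqueness_limite _ _ _ _ H0 H1); lra.
Qed.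

(** * Mean curvature of a rotational surface of hyperbolic type *)

(** The coordinate frame is orthogonal with [g11 = 1] and [g22 = - r^2], so the trace is
    [sigma(zu,zu) - sigma(zv,zv) / r^2]. Multiplying by [r^2 (r1^2 - 1)] clears the denominators and
    lets the squared length of [(a1, b1)] be expressed through the determinant [a b1 - a1 b]. *)
Lemma rot_hyp_curvature (zuv : V4) (r r1 r2 a a1 b b1 v : R) :
  r <> 0 ->
  r1 ^ 2 + a ^ 2 - b ^ 2 = 1 ->
  r1 * r2 + a * a1 - b * b1 = 0 ->
  let zu := mkV4 (r1 * cosh v) a (r1 * sinh v) b in
  let zv := mkV4 (r * sinh v) 0 (r * cosh v) 0 in
  let zuu := mkV4 (r2 * cosh v) a1 (r2 * sinh v) b1 in
  let zvv := mkV4 (r * cosh v) 0 (r * sinh v) 0 in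
  lorentz_at zu zv /\
  4 * HH zu zv zuu zuv zvv * (r ^ 2 * (r1 ^ 2 - 1)) =
  r ^ 2 * (a * b1 - a1 * b) ^ 2 - (r * r2 + r1 ^ 2 - 1) ^ 2.
Proof.
  intros Hr Harc Hder zu zv zuu zvv.
  pose proof (cosh_sqr v) as Hv.
  assert (E11 : g11 zu = 1) by (unfold g11, ip; simpl;
    transitivity (r1 ^ 2 * (cosh v ^ 2 - sinh v ^ 2) + a ^ 2 - b ^ 2); [ring|rewrite Hv; lra]).
  assert (E12 : g12 zu zv = 0) by (unfold g12, ip; simpl; ring).
  assert (E22 : g22 zv = - r ^ 2) by (unfold g22, ip; simpl;
    transitivity (- r ^ 2 * (cosh v ^ 2 - sinh v ^ 2)); [ring|rewrite Hv; lra]).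
  assert (Ed : gdet zu zv = - r ^ 2).
  { unfold gdet; rewrite E11, E12, E22; ring. }
  assert (Hr2 : 0 < r ^ 2) by (apply pow2_gt_0; exact Hr).
  split; [unfold lorentz_at; lra|].
  assert (G11 : gi11 zu zv = 1).
  { unfold gi11; rewrite E22, Ed; field; exact Hr. }
  assert (G12 : gi12 zu zv = 0).
  { unfold gi12; rewrite E12, Ed; field; exact Hr. }
  assert (G22 : gi22 zu zv = - / r ^ 2).
  { unfold gi22; rewrite E11, Ed; field; exact Hr. }
  assert (I1 : ip zuu zu = 0) by (unfold ip; simpl;
    transitivity (r1 * r2 * (cosh v ^ 2 - sinh v ^ 2) + a * a1 - b * b1); [ring|rewrite Hv; lra]).
  assert (I2 : ip zuu zv = 0) by (unfold ip; simpl; ring).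
  assert (I3 : ip zvv zu = r * r1) by (unfold ip; simpl;
    transitivity (r * r1 * (cosh v ^ 2 - sinh v ^ 2)); [ring|rewrite Hv; lra]).
  assert (I4 : ip zvv zv = 0) by (unfold ip; simpl; ring).
  (* [zuu] is already normal, and the tangential part of [zvv] is [r r1 zu]. Hence
     [H = (zuu - zvv / r^2 + (r1 / r) zu) / 2]. *)
  assert (EH : mean_curv_vec zu zv zuu zuv zvv =
    mkV4 ((r * r2 + r1 ^ 2 - 1) / (2 * r) * cosh v) ((a1 + r1 * a / r) / 2)
         ((r * r2 + r1 ^ 2 - 1) / (2 * r) * sinh v) ((b1 + r1 * b / r) / 2)).
  { unfold mean_curv_vec, normal_part; rewrite G11, G12, G22, I1, I2, I3, I4.
    unfold vadd, vscale; simpl; f_equal; field; exact Hr. }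
  unfold HH; rewrite EH; unfold ip; cbn [Defs.c1 c2 c3 c4].
  set (q := r1 ^ 2 - 1).
  set (X := a1 ^ 2 - b1 ^ 2).
  assert (Hab : a ^ 2 - b ^ 2 = - q) by (unfold q; lra).
  assert (Haa : a * a1 - b * b1 = - (r1 * r2)) by lra.
  (* Lorentzian Lagrange identity: [(a^2 - b^2)(a1^2 - b1^2) = (a a1 - b b1)^2 - (a b1 - a1
     b)^2]. *)
  assert (HX : q * X = (a * b1 - a1 * b) ^ 2 - (r1 * r2) ^ 2).
  { replace q with (- (a ^ 2 - b ^ 2)) by lra.
    replace ((r1 * r2) ^ 2) with ((a * a1 - b * b1) ^ 2) by (rewrite Haa; ring).
    unfold X; ring. }
  transitivity (q * (r * r2 + r1 ^ 2 - 1) ^ 2 * (cosh v ^ 2 - sinh v ^ 2)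
    + r ^ 2 * (q * X) + 2 * r * r1 * q * (a * a1 - b * b1)
    + r1 ^ 2 * q * (a ^ 2 - b ^ 2)).
  { unfold X, q; field; exact Hr. }
  (* The terms free of the determinant combine to [(q - r1^2)(r r2 + q)^2], and [q - r1^2 = -1]. *)
  rewrite Hv, HX, Hab, Haa; unfold q; ring.
Qed.

Lemma derivable_pt_lim_Rmult_const (f : R -> R) (u l k : R) :
  derivable_pt_lim f u l -> derivable_pt_lim (fun t => f t * k) u (l * k).
Proof.
  intros Hf; apply is_derive_Reals; apply is_derive_Reals in Hf.
  exact (is_derive_scal_l (K := R_AbsRing) (V := R_NormedModule) f u l k Hf).
Qed.

Lemma derivable_pt_lim_mult_cosh (k v : R) :
  derivable_pt_lim (fun t => k * cosh t) v (k * sinh v).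
Proof.
  apply (derivable_pt_lim_scal cosh k v (sinh v)), derivable_pt_lim_cosh.
Qed.

Lemma derivable_pt_lim_mult_sinh (k v : R) :
  derivable_pt_lim (fun t => k * sinh t) v (k * cosh v).
Proof.
  apply (derivable_pt_lim_scal sinh k v (cosh v)), derivable_pt_lim_sinh.
Qed.

Create HintDb rot.
#[local] Hint Resolve derivable_pt_lim_Rmult_const derivable_pt_lim_mult_cosh
  derivable_pt_lim_mult_sinh : rot.
#[local] Hint Extern 1 (derivable_pt_lim _ _ 0) =>
  apply derivable_pt_lim_const : rot.

(** The partial derivatives are explicit. The curvature identity then determines [HH], because its
    factor [r^2 (r1^2 - 1)] does not vanish. *)
Lemma rot_hyp_lorentz_with_HH (I : R -> Prop)
    (r r1 r2 x2 a a1 x4 b b1 : R -> R) (h : R) :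
  is_open_interval I ->
  (forall u, I u ->
     derivable_pt_lim r u (r1 u) /\ derivable_pt_lim r1 u (r2 u) /\
     derivable_pt_lim x2 u (a u) /\ derivable_pt_lim a u (a1 u) /\
     derivable_pt_lim x4 u (b u) /\ derivable_pt_lim b u (b1 u)) ->
  (forall u, I u -> r u > 0) ->
  (forall u, I u -> r1 u ^ 2 <> 1) ->
  (forall u, I u -> r1 u ^ 2 + a u ^ 2 - b u ^ 2 = 1) ->
  (forall u, I u -> r u ^ 2 * (a u * b1 u - a1 u * b u) ^ 2 =
     (r u * r2 u + r1 u ^ 2 - 1) ^ 2 + 4 * h * r u ^ 2 * (r1 u ^ 2 - 1)) ->
  lorentz_with_HH (fun u _ => I u) (rot_hyp r x2 x4) h.
Proof.
  intros HI Hd Hr Hq Harc HW.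
  exists (fun u v => mkV4 (r1 u * cosh v) (a u) (r1 u * sinh v) (b u)),
    (fun u v => mkV4 (r u * sinh v) 0 (r u * cosh v) 0),
    (fun u v => mkV4 (r2 u * cosh v) (a1 u) (r2 u * sinh v) (b1 u)),
    (fun u v => mkV4 (r1 u * sinh v) 0 (r1 u * cosh v) 0),
    (fun u v => mkV4 (r u * cosh v) 0 (r u * sinh v) 0).
  split.
  - split; [|split; [|split; [|split; [|split]]]]; intros u v Hu;
      destruct (Hd u Hu) as (? & ? & ? & ? & ? & ?);
      cbn [rot_hyp Defs.c1 c2 c3 c4]; auto 6 with rot.
  - intros u v Hu.
    destruct (Hd u Hu) as (D1 & D2 & _ & D3 & _ & D4).
    assert (Hder : r1 u * r2 u + a u * a1 u - b u * b1 u = 0)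
      by exact (arc_length_derivative I r1 r2 a a1 b b1 1 u HI Hu Harc D2 D3 D4).
    pose proof (Hr u Hu) as Hru; pose proof (Hq u Hu) as Hqu.
    destruct (rot_hyp_curvature (mkV4 (r1 u * sinh v) 0 (r1 u * cosh v) 0)
      (r u) (r1 u) (r2 u) (a u) (a1 u) (b u) (b1 u) v) as [HL HH]; auto; [lra|].
    split; [exact HL|].
    rewrite (HW u Hu) in HH.
    apply (Rmult_eq_reg_r (4 * (r u ^ 2 * (r1 u ^ 2 - 1)))).
    + lra.
    + apply Rmult_integral_contrapositive; split; [lra|].
      apply Rmult_integral_contrapositive; split; [|lra].
      apply pow_nonzero; lra.
Qed.

(** The partial derivatives are now only known to exist; uniqueness of limits identifies them with
    the explicit ones, and the slice [v = 0] suffices to read off the equation. *)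
Lemma rot_hyp_HH_equation (I : R -> Prop)
    (r r1 r2 x2 a a1 x4 b b1 : R -> R) (h : R) :
  is_open_interval I ->
  (forall u, I u ->
     derivable_pt_lim r u (r1 u) /\ derivable_pt_lim r1 u (r2 u) /\
     derivable_pt_lim x2 u (a u) /\ derivable_pt_lim a u (a1 u) /\
     derivable_pt_lim x4 u (b u) /\ derivable_pt_lim b u (b1 u)) ->
  (forall u, I u -> r u > 0) ->
  (forall u, I u -> r1 u ^ 2 + a u ^ 2 - b u ^ 2 = 1) ->
  lorentz_with_HH (fun u _ => I u) (rot_hyp r x2 x4) h ->
  forall u, I u -> r u ^ 2 * (a u * b1 u - a1 u * b u) ^ 2 =
     (r u * r2 u + r1 u ^ 2 - 1) ^ 2 + 4 * h * r u ^ 2 * (r1 u ^ 2 - 1).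
Proof.
  intros HI Hd Hr Harc
    (zu & zv & zuu & zuv & zvv & (Hu & Hv & Huu & _ & _ & Hvv) & HHH) u Iu.
  assert (V4_ext : forall p q : V4, Defs.c1 p = Defs.c1 q -> c2 p = c2 q ->
    c3 p = c3 q -> c4 p = c4 q -> p = q).
  { intros [] []; simpl; intros; subst; reflexivity. }
  (* The first derivatives are identified along whole lines, [v = 0] for [zu] and fixed [u] for
     [zv], since they are differentiated once more along these lines. *)
  assert (Ezu : forall t, I t ->
    zu t 0 = mkV4 (r1 t * cosh 0) (a t) (r1 t * sinh 0) (b t)).
  { intros t It; destruct (Hu t 0 It) as (A1 & A2 & A3 & A4).
    destruct (Hd t It) as (? & _ & ? & _ & ? & _).
    apply V4_ext; (eapply uniqueness_limite; [eassumption|]);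
      cbn [rot_hyp Defs.c1 c2 c3 c4]; auto with rot. }
  assert (Ezv : forall v,
    zv u v = mkV4 (r u * sinh v) 0 (r u * cosh v) 0).
  { intros v; destruct (Hv u v Iu) as (A1 & A2 & A3 & A4).
    apply V4_ext; (eapply uniqueness_limite; [eassumption|]);
      cbn [rot_hyp Defs.c1 c2 c3 c4]; auto with rot. }
  assert (Ezuu : zuu u 0 = mkV4 (r2 u * cosh 0) (a1 u) (r2 u * sinh 0) (b1 u)).
  { destruct (Huu u 0 Iu) as (A1 & A2 & A3 & A4).
    destruct (Hd u Iu) as (_ & ? & _ & ? & _ & ?).
    apply V4_ext;
      (eapply uniqueness_limite;
        [eapply (derivable_pt_lim_ext_on I); [exact HI|exact Iu| |eassumption];
         intros t It; cbv beta; rewrite (Ezu t It); reflexivity|]);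
      cbn [rot_hyp Defs.c1 c2 c3 c4]; auto with rot. }
  assert (Ezvv : zvv u 0 = mkV4 (r u * cosh 0) 0 (r u * sinh 0) 0).
  { destruct (Hvv u 0 Iu) as (A1 & A2 & A3 & A4).
    apply V4_ext;
      (eapply uniqueness_limite;
        [eapply derivable_pt_lim_ext; [|eassumption];
         intros t; cbv beta; rewrite (Ezv t); reflexivity|]);
      cbn [rot_hyp Defs.c1 c2 c3 c4]; auto with rot. }
  destruct (HHH u 0 Iu) as [_ E].
  rewrite (Ezu u Iu), Ezv, Ezuu, Ezvv in E.
  destruct (Hd u Iu) as (D1 & D2 & _ & D3 & _ & D4).
  assert (Hder : r1 u * r2 u + a u * a1 u - b u * b1 u = 0)
    by exact (arc_length_derivative I r1 r2 a a1 b b1 1 u HI Iu Harc D2 D3 D4).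
  pose proof (Hr u Iu) as Hru.
  destruct (rot_hyp_curvature (zuv u 0)
    (r u) (r1 u) (r2 u) (a u) (a1 u) (b u) (b1 u) 0) as [_ F]; auto; [lra|].
  rewrite E in F; lra.
Qed.

(** * From the angle [phi] to the generating curve *)

Lemma derivable_pt_lim_sqrt_sinh (Q phi : R -> R) (u Q1 p : R) :
  0 < Q u -> derivable_pt_lim Q u Q1 -> derivable_pt_lim phi u p ->
  derivable_pt_lim (fun t => sqrt (Q t) * sinh (phi t)) u
    (Q1 / (2 * sqrt (Q u)) * sinh (phi u) + sqrt (Q u) * cosh (phi u) * p).
Proof.
  intros HQ DQ Dphi; apply is_derive_Reals in DQ, Dphi; apply is_derive_Reals.
  auto_derive.
  - repeat split; [eexists; eassumption|exact HQ|eexists; eassumption].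
  - rewrite (is_derive_unique (fun t : R => Q t) _ _ DQ),
      (is_derive_unique (fun t : R => phi t) _ _ Dphi).
    field; apply Rgt_not_eq, sqrt_lt_R0, HQ.
Qed.

Lemma derivable_pt_lim_sqrt_cosh (Q phi : R -> R) (u Q1 p : R) :
  0 < Q u -> derivable_pt_lim Q u Q1 -> derivable_pt_lim phi u p ->
  derivable_pt_lim (fun t => sqrt (Q t) * cosh (phi t)) u
    (Q1 / (2 * sqrt (Q u)) * cosh (phi u) + sqrt (Q u) * sinh (phi u) * p).
Proof.
  intros HQ DQ Dphi; apply is_derive_Reals in DQ, Dphi; apply is_derive_Reals.
  auto_derive.
  - repeat split; [eexists; eassumption|exact HQ|eexists; eassumption].
  - rewrite (is_derive_unique (fun t : R => Q t) _ _ DQ),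
      (is_derive_unique (fun t : R => phi t) _ _ Dphi).
    field; apply Rgt_not_eq, sqrt_lt_R0, HQ.
Qed.

(** Here [s], [t] and [p] stand for the squared radius, its derivative and the derivative of the
    angle [v]. The terms in [t] are proportional to the position vector and cancel in the
    determinant; only the angular speed remains. *)
Lemma hyperbolic_frame_det (s t p v : R) :
  0 < s ->
  (sqrt s * sinh v) * (t / (2 * sqrt s) * cosh v + sqrt s * sinh v * p) -
  (t / (2 * sqrt s) * sinh v + sqrt s * cosh v * p) * (sqrt s * cosh v) =
  - s * p.
Proof.
  intros Hs.
  assert (H0 : sqrt s <> 0) by (apply Rgt_not_eq, sqrt_lt_R0, Hs).
  transitivity (sqrt s ^ 2 * p * (sinh v ^ 2 - cosh v ^ 2)); [field; exact H0|].
  rewrite cosh_sqr, pow2_sqrt by lra; ring.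
Qed.

(** Both cases lead to the same arc-length relation and the same formula [W = - q phi'], so the case
    distinction of the direct part ends here. *)
Lemma generating_curve_derivatives (I : R -> Prop) (r1 r2 phi p x2 x4 : R -> R) :
  (forall u, I u -> derivable_pt_lim r1 u (r2 u)) ->
  (forall u, I u -> derivable_pt_lim phi u (p u)) ->
  ((forall u, I u ->
      r1 u ^ 2 > 1 /\
      derivable_pt_lim x2 u (sqrt (r1 u ^ 2 - 1) * sinh (phi u)) /\
      derivable_pt_lim x4 u (sqrt (r1 u ^ 2 - 1) * cosh (phi u)))
   \/
   (forall u, I u ->
      r1 u ^ 2 < 1 /\
      derivable_pt_lim x2 u (sqrt (1 - r1 u ^ 2) * cosh (phi u)) /\
      derivable_pt_lim x4 u (sqrt (1 - r1 u ^ 2) * sinh (phi u)))) ->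
  exists a a1 b b1 : R -> R, forall u, I u ->
    derivable_pt_lim x2 u (a u) /\ derivable_pt_lim a u (a1 u) /\
    derivable_pt_lim x4 u (b u) /\ derivable_pt_lim b u (b1 u) /\
    r1 u ^ 2 + a u ^ 2 - b u ^ 2 = 1 /\
    a u * b1 u - a1 u * b u = - (r1 u ^ 2 - 1) * p u.
Proof.
  intros Dr Dphi [H|H].
  - assert (DQ : forall u, I u ->
      derivable_pt_lim (fun t => r1 t ^ 2 - 1) u (2 * r1 u * r2 u)).
    { intros u Hu; pose proof (Dr u Hu) as D.
      apply is_derive_Reals in D; apply is_derive_Reals; auto_derive.
      - eexists; eassumption.
      - rewrite (is_derive_unique (fun t : R => r1 t) _ _ D); ring. }
    do 4 eexists; intros u Hu.
    destruct (H u Hu) as (Hgt & D2 & D4).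
    split; [exact D2|]; split.
    { apply (derivable_pt_lim_sqrt_sinh (fun t => r1 t ^ 2 - 1) phi); auto; lra. }
    split; [exact D4|]; split.
    { apply (derivable_pt_lim_sqrt_cosh (fun t => r1 t ^ 2 - 1) phi); auto; lra. }
    split.
    + rewrite !Rpow_mult_distr, cosh_sqr, pow2_sqrt by lra; ring.
    + apply hyperbolic_frame_det; lra.
  - assert (DQ : forall u, I u ->
      derivable_pt_lim (fun t => 1 - r1 t ^ 2) u (- (2 * r1 u * r2 u))).
    { intros u Hu; pose proof (Dr u Hu) as D.
      apply is_derive_Reals in D; apply is_derive_Reals; auto_derive.
      - eexists; eassumption.
      - rewrite (is_derive_unique (fun t : R => r1 t) _ _ D); ring. }
    do 4 eexists; intros u Hu.
    destruct (H u Hu) as (Hlt & D2 & D4).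
    split; [exact D2|]; split.
    { apply (derivable_pt_lim_sqrt_cosh (fun t => 1 - r1 t ^ 2) phi); auto; lra. }
    split; [exact D4|]; split.
    { apply (derivable_pt_lim_sqrt_sinh (fun t => 1 - r1 t ^ 2) phi); auto; lra. }
    split.
    + rewrite !Rpow_mult_distr, cosh_sqr, pow2_sqrt by lra; ring.
    (* In Case (B) the roles of [a] and [b] are exchanged, which flips the determinant;
       [1 - r1^2 = - q] flips the sign a second time. *)
    + pose proof (hyperbolic_frame_det (1 - r1 u ^ 2) (- (2 * r1 u * r2 u)) (p u) (phi u)).
      lra.
Qed.

(** * From the generating curve back to the angle *)

Lemma is_sign_sqr (s : R) : is_sign s -> s * s = 1.
Proof. intros [->| ->]; ring. Qed.

(** The signs [s] and [k] make the arguments of [ln] and [sqrt] positive and cancel in the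
    logarithmic derivative [(a1 + b1) / (a + b) - q1 / (2 q)]. With [q = (b - a)(b + a)] and
    [q1 = 2 (b b1 - a a1)] this is [- (a b1 - a1 b) / q]. *)
Lemma hyperbolic_angle_derivative (a b q : R -> R) (u a1 b1 q1 k s : R) :
  is_sign k -> is_sign s ->
  0 < k * q u -> 0 < s * (a u + b u) ->
  b u ^ 2 - a u ^ 2 = q u ->
  2 * (b u * b1 - a u * a1) = q1 ->
  derivable_pt_lim a u a1 -> derivable_pt_lim b u b1 ->
  derivable_pt_lim q u q1 ->
  derivable_pt_lim (fun t => ln (s * (a t + b t) / sqrt (k * q t))) u
    (- (a u * b1 - a1 * b u) / q u).
Proof.
  intros Hk Hs Hkq Hsab Harc Harc1 Da Db Dq.
  apply is_derive_Reals in Da, Db, Dq; apply is_derive_Reals.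
  assert (Hsq : 0 < sqrt (k * q u)) by (apply sqrt_lt_R0, Hkq).
  auto_derive.
  - repeat split; try (eexists; eassumption); auto.
    + lra.
    + apply Rdiv_lt_0_compat; assumption.
  - rewrite (is_derive_unique (fun t : R => a t) _ _ Da),
      (is_derive_unique (fun t : R => b t) _ _ Db),
      (is_derive_unique (fun t : R => q t) _ _ Dq).
    assert (Hs0 : s <> 0) by (destruct Hs; lra).
    assert (Hk0 : k <> 0) by (destruct Hk; lra).
    assert (Hab : a u + b u <> 0) by (intros E; rewrite E in Hsab; lra).
    assert (Hq0 : q u <> 0) by (intros E; rewrite E in Hkq; lra).
    assert (Hba : b u - a u <> 0).
    { intros E; apply Hq0; rewrite <- Harc.
      replace (b u) with (a u) by lra; ring. }
    transitivity ((a1 + b1) / (a u + b u) - k * q1 / (2 * sqrt (k * q u) ^ 2)).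
    { field; repeat split; auto; lra. }
    rewrite pow2_sqrt by lra.
    rewrite <- Harc1.
    replace (q u) with ((b u - a u) * (b u + a u)) by (rewrite <- Harc; ring).
    field; repeat split; auto; lra.
Qed.

(** Up to the factor [s], [sqrt (k q)] times [exp phi] and [exp (- phi)] are [a + b] and
    [k (b - a)]; half their difference and half their sum give the claims. The right-hand sides are
    [a, b] for [k = 1] and [b, a] for [k = -1], which covers Cases (A) and (B) together. *)
Lemma hyperbolic_angle_components (a b q k s : R) :
  is_sign k -> is_sign s ->
  0 < k * q -> 0 < s * (a + b) -> b ^ 2 - a ^ 2 = q ->
  let phi := ln (s * (a + b) / sqrt (k * q)) in
  s * (sqrt (k * q) * sinh phi) = ((1 + k) * a + (1 - k) * b) / 2 /\
  s * (sqrt (k * q) * cosh phi) = ((1 - k) * a + (1 + k) * b) / 2.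
Proof.
  intros Hk Hs Hkq Hsab Harc phi.
  assert (Hsq : 0 < sqrt (k * q)) by (apply sqrt_lt_R0, Hkq).
  assert (Hs0 : s <> 0) by (destruct Hs; lra).
  assert (Hab : a + b <> 0) by (intros E; rewrite E in Hsab; lra).
  assert (E1 : exp phi = s * (a + b) / sqrt (k * q)).
  { apply exp_ln, Rdiv_lt_0_compat; assumption. }
  assert (E2 : exp (- phi) = sqrt (k * q) / (s * (a + b))).
  { rewrite exp_Ropp, E1; field; repeat split; auto; lra. }
  assert (F1 : s * (sqrt (k * q) * exp phi) = a + b).
  { transitivity (s * s * (a + b)); [rewrite E1; field; lra|].
    rewrite is_sign_sqr by exact Hs; ring. }
  assert (F2 : s * (sqrt (k * q) * exp (- phi)) = k * (b - a)).
  { transitivity (sqrt (k * q) ^ 2 / (a + b)); [rewrite E2; field; auto|].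
    rewrite pow2_sqrt by lra; rewrite <- Harc; field; exact Hab. }
  unfold sinh, cosh; split; lra.
Qed.

(** * The construction and its converse *)

(** The sign [sigma] enters the converse because the construction makes [x4'] positive in Case (A)
    and [x2'] positive in Case (B), whereas a given curve may have either sign. *)
Theorem theorem3p2 :
  (* Direct part *)
  (forall (I : R -> Prop) (r r1 r2 phi x2 x4 : R -> R) (C eta eps : R),
     is_open_interval I ->
     smooth_on I r ->
     (forall u, I u -> derivable_pt_lim r u (r1 u)) ->
     (forall u, I u -> derivable_pt_lim r1 u (r2 u)) ->
     (forall u, I u -> r u > 0) ->
     (forall u, I u -> r1 u ^ 2 <> 1) ->
     C <> 0 -> is_sign eta -> is_sign eps ->
     (forall u, I u -> Rfun eps C r r1 r2 u > 0) ->
     (forall u, I u -> derivable_pt_lim phi u (phi_rhs eta eps C r r1 r2 u)) ->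
     ((* Case (A) *)
      (forall u, I u ->
         r1 u ^ 2 > 1 /\
         derivable_pt_lim x2 u (sqrt (r1 u ^ 2 - 1) * sinh (phi u)) /\
         derivable_pt_lim x4 u (sqrt (r1 u ^ 2 - 1) * cosh (phi u)))
      \/
      (* Case (B) *)
      (forall u, I u ->
         r1 u ^ 2 < 1 /\
         derivable_pt_lim x2 u (sqrt (1 - r1 u ^ 2) * cosh (phi u)) /\
         derivable_pt_lim x4 u (sqrt (1 - r1 u ^ 2) * sinh (phi u)))) ->
     (exists d2 d4 e2 e4 : R -> R,
        forall u, I u ->
          derivable_pt_lim x2 u (d2 u) /\ derivable_pt_lim d2 u (e2 u) /\
          derivable_pt_lim x4 u (d4 u) /\ derivable_pt_lim d4 u (e4 u) /\
          spacelike (mkV4 (r1 u) (d2 u) 0 (d4 u)) /\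
          ip (mkV4 (r1 u) (d2 u) 0 (d4 u)) (mkV4 (r1 u) (d2 u) 0 (d4 u)) = 1 /\
          d2 u * e4 u - e2 u * d4 u <> 0) /\
     lorentz_with_HH (fun u _ => I u) (rot_hyp r x2 x4) (eps * C ^ 2))
  /\
  (* Converse *)
  (forall (J I : R -> Prop) (r r1 r2 x2 x21 x22 x4 x41 x42 : R -> R),
     is_open_interval J ->
     smooth_on J r -> smooth_on J x2 -> smooth_on J x4 ->
     (forall u, J u -> derivable_pt_lim r u (r1 u)) ->
     (forall u, J u -> derivable_pt_lim r1 u (r2 u)) ->
     (forall u, J u -> derivable_pt_lim x2 u (x21 u)) ->
     (forall u, J u -> derivable_pt_lim x21 u (x22 u)) ->
     (forall u, J u -> derivable_pt_lim x4 u (x41 u)) ->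
     (forall u, J u -> derivable_pt_lim x41 u (x42 u)) ->
     (forall u, J u -> r u > 0) ->
     (forall u, J u -> r1 u ^ 2 <> 1) ->
     (forall u, J u -> r1 u ^ 2 + x21 u ^ 2 - x41 u ^ 2 = 1) ->
     is_open_interval I ->
     (forall u, I u -> J u) ->
     (forall u, I u -> x21 u * x42 u - x22 u * x41 u <> 0) ->
     (exists h, h <> 0 /\ lorentz_with_HH (fun u _ => I u) (rot_hyp r x2 x4) h) ->
     forall u0, I u0 ->
       exists (I0 : R -> Prop) (C eta eps sigma : R) (phi : R -> R),
         is_open_interval I0 /\ I0 u0 /\ (forall u, I0 u -> I u) /\
         C <> 0 /\ is_sign eta /\ is_sign eps /\ is_sign sigma /\
         (forall u, I0 u -> Rfun eps C r r1 r2 u > 0) /\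
         (forall u, I0 u -> derivable_pt_lim phi u (phi_rhs eta eps C r r1 r2 u)) /\
         ((* Case (A), up to the isometry (x2,x4) |-> sigma (x2,x4) *)
          (forall u, I0 u ->
             r1 u ^ 2 > 1 /\
             x21 u = sigma * (sqrt (r1 u ^ 2 - 1) * sinh (phi u)) /\
             x41 u = sigma * (sqrt (r1 u ^ 2 - 1) * cosh (phi u)))
          \/
          (* Case (B) *)
          (forall u, I0 u ->
             r1 u ^ 2 < 1 /\
             x21 u = sigma * (sqrt (1 - r1 u ^ 2) * cosh (phi u)) /\
             x41 u = sigma * (sqrt (1 - r1 u ^ 2) * sinh (phi u))))).
Proof.
  split.
  - intros I r r1 r2 phi x2 x4 C eta eps HI _ Dr Dr1 Hr Hq HC Heta _ HR Dphi HAB.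
    destruct (generating_curve_derivatives I r1 r2 phi
      (phi_rhs eta eps C r r1 r2) x2 x4 Dr1 Dphi HAB) as (a & a1 & b & b1 & H).
    (* Squaring [W = - q phi'] removes both [eta] and the root of the prescribed [phi']. *)
    assert (HW : forall u, I u ->
      r u ^ 2 * (a u * b1 u - a1 u * b u) ^ 2 = Rfun eps C r r1 r2 u).
    { intros u Hu; destruct (H u Hu) as (_ & _ & _ & _ & _ & ->).
      pose proof (Hr u Hu); pose proof (Hq u Hu); pose proof (HR u Hu).
      unfold phi_rhs.
      transitivity (eta * eta * sqrt (Rfun eps C r r1 r2 u) ^ 2).
      - field; split; lra.
      - rewrite is_sign_sqr by exact Heta; rewrite pow2_sqrt by lra; ring. }
    split.
    + exists a, b, a1, b1; intros u Hu.
      destruct (H u Hu) as (D1 & D2 & D3 & D4 & Harc & _).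
      assert (E : ip (mkV4 (r1 u) (a u) 0 (b u)) (mkV4 (r1 u) (a u) 0 (b u)) = 1)
        by (unfold ip; cbn [Defs.c1 c2 c3 c4]; lra).
      do 4 (split; [assumption|]).
      split; [unfold spacelike; lra|]; split; [exact E|].
      intros W0; pose proof (HR u Hu) as HRu.
      rewrite <- (HW u Hu), W0 in HRu; lra.
    + apply (rot_hyp_lorentz_with_HH I r r1 r2 x2 a a1 x4 b b1); auto.
      * intros u Hu; destruct (H u Hu) as (? & ? & ? & ? & _); auto 6.
      * intros u Hu; apply (H u Hu).
      * intros u Hu; rewrite (HW u Hu); unfold Rfun; ring.
  - intros J I r r1 r2 x2 a a1 x4 b b1 HJ _ S2 S4 Dr Dr1 D2 Da D4 Db
      Hr Hq Harc HI HIJ HW (h & Hh & HL) u0 Hu0.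
    assert (Ju0 := HIJ u0 Hu0).
    assert (HE : forall u, I u -> r u ^ 2 * (a u * b1 u - a1 u * b u) ^ 2 =
      (r u * r2 u + r1 u ^ 2 - 1) ^ 2 + 4 * h * r u ^ 2 * (r1 u ^ 2 - 1)).
    { apply (rot_hyp_HH_equation I r r1 r2 x2 a a1 x4 b b1 h); auto 10. }
    pose (q := fun t => r1 t ^ 2 - 1).
    pose (W := fun t => a t * b1 t - a1 t * b t).
    assert (Dq : forall u, J u -> derivable_pt_lim q u (2 * r1 u * r2 u)).
    { intros u Hu; pose proof (Dr1 u Hu) as D.
      apply is_derive_Reals in D; apply is_derive_Reals; unfold q; auto_derive.
      - eexists; eassumption.
      - rewrite (is_derive_unique (fun t : R => r1 t) _ _ D); ring. }
    assert (Ca := derivable_pt_lim_continuous _ _ _ (Da u0 Ju0)).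
    assert (Cb := derivable_pt_lim_continuous _ _ _ (Db u0 Ju0)).
    assert (Ca1 := smooth_on_continuous_2 J x2 a a1 u0 HJ S2 D2 Da Ju0).
    assert (Cb1 := smooth_on_continuous_2 J x4 b b1 u0 HJ S4 D4 Db Ju0).
    (* Three signs are frozen near [u0]: [k] of [q] selects the case, [s] of [a + b] becomes
       [sigma], and [w] of [W] determines [eta]. *)
    destruct (locally_sign q u0) as (k & Hk & Lk).
    { apply (derivable_pt_lim_continuous _ _ _ (Dq u0 Ju0)). }
    { unfold q; pose proof (Hq u0 Ju0); lra. }
    destruct (locally_sign (fun t => a t + b t) u0) as (s & Hs & Ls).
    { exact (continuous_plus a b u0 Ca Cb). }
    (* If [a + b] vanished, then [a^2 = b^2] and arc length would force [r1^2 = 1]. *)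
    { intros E; apply (Hq u0 Ju0); pose proof (Harc u0 Ju0).
      replace (a u0) with (- b u0) in * by lra; lra. }
    destruct (locally_sign W u0) as (w & Hw & Lw).
    { apply (continuous_minus (fun t => a t * b1 t) (fun t => a1 t * b t)).
      - exact (continuous_mult a b1 u0 Ca Cb1).
      - exact (continuous_mult a1 b u0 Ca1 Cb). }
    { exact (HW u0 Hu0). }
    destruct (locally_open_interval
      (fun t => I t /\ k * q t > 0 /\ s * (a t + b t) > 0 /\ w * W t > 0) u0)
      as (I0 & HI0 & I0u0 & HP).
    { repeat apply filter_and; auto; apply open_interval_locally; assumption. }
    (* [eps] is the sign of [h], so [C = sqrt (eps h)] satisfies [eps C^2 = h]. *)
    assert (Heps : exists eps, is_sign eps /\ 0 < eps * h).
    { destruct (Rlt_or_le h 0); [exists (-1)|exists 1]; (split; [|lra]).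
      - right; reflexivity.
      - left; reflexivity. }
    destruct Heps as (eps & Heps & Hepsh).
    assert (HR : forall u, I u ->
      Rfun eps (sqrt (eps * h)) r r1 r2 u = (r u * W u) ^ 2).
    { intros u Hu; unfold Rfun, W; rewrite pow2_sqrt by lra.
      rewrite Rpow_mult_distr, (HE u Hu).
      replace (eps * 4 * (eps * h)) with (eps * eps * (4 * h)) by ring.
      rewrite is_sign_sqr by exact Heps; ring. }
    (* The angle solves [exp phi = |a + b| / sqrt |q|]. Since [phi' = - W / q] and [sqrt R = r w W],
       the sign [eta] must be [- w]. *)
    exists I0, (sqrt (eps * h)), (- w), eps, s,
      (fun t => ln (s * (a t + b t) / sqrt (k * q t))).
    split; [exact HI0|]; split; [exact I0u0|].
    split; [intros u Hu; apply (HP u Hu)|].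
    split; [apply Rgt_not_eq, sqrt_lt_R0, Hepsh|].
    split; [destruct Hw as [->| ->]; [right|left]; ring|].
    split; [exact Heps|]; split; [exact Hs|].
    split; [|split].
    + intros u Hu; destruct (HP u Hu) as (Iu & _ & _ & Pw).
      rewrite (HR u Iu); apply pow2_gt_0.
      pose proof (Hr u (HIJ u Iu)).
      apply Rmult_integral_contrapositive; split; [lra|].
      intros E; rewrite E in Pw; lra.
    + intros u Hu; destruct (HP u Hu) as (Iu & Pk & Ps & Pw).
      assert (Ju := HIJ u Iu); pose proof (Hr u Ju) as Hru.
      assert (Hqu : q u <> 0) by (intros E; rewrite E in Pk; lra).
      replace (phi_rhs (- w) eps (sqrt (eps * h)) r r1 r2 u)
        with (- (a u * b1 u - a1 u * b u) / q u).
      * apply (hyperbolic_angle_derivative a b q u (a1 u) (b1 u)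
          (2 * r1 u * r2 u) k s); auto.
        -- unfold q; pose proof (Harc u Ju); lra.
        -- pose proof (arc_length_derivative J r1 r2 a a1 b b1 1 u HJ Ju Harc
             (Dr1 u Ju) (Da u Ju) (Db u Ju)); lra.
      * unfold phi_rhs; rewrite (HR u Iu).
        (* Inserting [w] makes the base positive, so the root opens without an absolute value. *)
        replace ((r u * W u) ^ 2) with ((r u * (w * W u)) ^ 2).
        2: { transitivity (w * w * (r u * W u) ^ 2); [ring|].
             rewrite is_sign_sqr by exact Hw; ring. }
        rewrite sqrt_pow2 by (apply Rmult_le_pos; lra).
        change (r1 u ^ 2 - 1) with (q u).
        change (a u * b1 u - a1 u * b u) with (W u).
        transitivity (- (w * w) * W u / q u); [|field; split; lra].
        rewrite is_sign_sqr by exact Hw; field; exact Hqu.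
    + assert (HC : forall u, I0 u ->
        s * (sqrt (k * q u) * sinh (ln (s * (a u + b u) / sqrt (k * q u)))) =
          ((1 + k) * a u + (1 - k) * b u) / 2 /\
        s * (sqrt (k * q u) * cosh (ln (s * (a u + b u) / sqrt (k * q u)))) =
          ((1 - k) * a u + (1 + k) * b u) / 2).
      { intros u Hu; destruct (HP u Hu) as (Iu & Pk & Ps & _).
        apply hyperbolic_angle_components; auto.
        unfold q; pose proof (Harc u (HIJ u Iu)); lra. }
      (* [k = 1] means [q > 0], which is Case (A); [k = -1] is Case (B). *)
      destruct Hk as [Ek|Ek]; [left|right]; intros u Hu;
        destruct (HP u Hu) as (Iu & Pk & _ & _); destruct (HC u Hu) as [Es Ec].
      * replace (r1 u ^ 2 - 1) with (k * q u) by (rewrite Ek; unfold q; ring).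
        rewrite Es, Ec, Ek; rewrite Ek in Pk; unfold q in Pk.
        repeat split; lra.
      * replace (1 - r1 u ^ 2) with (k * q u) by (rewrite Ek; unfold q; ring).
        rewrite Es, Ec, Ek; rewrite Ek in Pk; unfold q in Pk.
        repeat split; lra.
Qed.
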